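(* Define polynomials $\overline{P}_n(x)$ by $\overline{P}_0(x)=1$ and, for $n\ge1$, $\overline{P}_{n}(x)=\frac{x}{n}\sum_{k=1}^{n} \overline{\sigma}(k)\, \overline{P}_{n-k}(x)$, where for $n=2^m l$ with $l$ odd, $\overline{\sigma}(n)=2^{m+1}\sigma(l)$ with $\sigma(l)=\sum_{d\mid l}d$. Let $a\ge b$ be positive integers and $x\ge1$ a real number. Then \[\overline{P}_{a}(x)\, \overline{P}_{b}(x)>\overline{P}_{a+b}(x),\] except for $(a,b,x)=(1,1,1),(2,1,1)$. *)

(* Defs.v *)
From HB Require Import structures.
From mathcomp Require Import all_boot all_order all_algebra.
From mathcomp Require Import reals.

Set Implicit Arguments.
Unset Strict Implicit.
Unset Printing Implicit Defensive.

Import GRing.Theory.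
Local Open Scope ring_scope.

Definition sigma (n : nat) : nat := (\sum_(d <- divisors n) d)%N.

(* The odd part l of n = 2 ^ m * l is obtained as n %/ 2 ^ logn 2 n. *)
Definition sigmabar (n : nat) : nat :=
  (2 ^ (logn 2 n).+1 * sigma (n %/ 2 ^ logn 2 n))%N.

Lemma sigmabarE (m l : nat) :
  odd l -> sigmabar (2 ^ m * l) = (2 ^ m.+1 * sigma l)%N.
Proof.
move=> odd_l; have l_gt0 : (0 < l)%N by case: l odd_l.
have logE : logn 2 (2 ^ m * l) = m.
  rewrite lognM ?expn_gt0 // pfactorK // [logn 2 l]logn_coprime ?addn0 //.
  by rewrite coprime2n.
by rewrite /sigmabar logE mulKn // expn_gt0.
Qed.

(* The recursion is course-of-values, so the list [:: P_0; ...; P_n] is built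
   first. *)
Fixpoint Pbar_seq (R : fieldType) (n : nat) : seq {poly R} :=
  if n is n'.+1 then
    let s := Pbar_seq R n' in
    rcons s (n%:R^-1 *: 'X *
      \sum_(1 <= k < n.+1) (sigmabar k)%:R *: nth 0 s (n - k))
  else [:: 1].

Definition Pbar (R : fieldType) (n : nat) : {poly R} := nth 0 (Pbar_seq R n) n.

Lemma size_Pbar_seq (R : fieldType) (n : nat) : size (Pbar_seq R n) = n.+1.
Proof. by elim: n => //= n IHn; rewrite size_rcons IHn. Qed.

Lemma nth_Pbar_seq (R : fieldType) (n i : nat) :
  (i <= n)%N -> nth 0 (Pbar_seq R n) i = Pbar R i.
Proof.
elim: n => [|n IHn]; first by rewrite leqn0 => /eqP->.
rewrite leq_eqVlt => /predU1P[-> //|lt_in].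
by rewrite [Pbar_seq R n.+1]/= nth_rcons size_Pbar_seq lt_in IHn.
Qed.

Lemma Pbar0 (R : fieldType) : Pbar R 0 = 1.
Proof. by []. Qed.

Lemma PbarE (R : fieldType) (n : nat) : (0 < n)%N ->
  Pbar R n = n%:R^-1 *: 'X * \sum_(1 <= k < n.+1) (sigmabar k)%:R *: Pbar R (n - k).
Proof.
case: n => // n _; rewrite {1}/Pbar [Pbar_seq R n.+1]/=.
rewrite nth_rcons size_Pbar_seq ltnn eqxx; congr (_ * _).
apply: eq_big_nat => k /andP[k_gt0 _]; rewrite nth_Pbar_seq //.
by case: k k_gt0 => // k _; rewrite subSS leq_subr.
Qed.

(* Main.v *)
Require Import Defs.
From HB Require Import structures.
From mathcomp Require Import all_boot all_order all_algebra.
From mathcomp Require Import reals.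
From mathcomp Require Import zify ring lra.

Import Order.TTheory GRing.Theory Num.Theory.
Local Open Scope ring_scope.

                                                                           
                                                              
                                                                           
                                                                              
                                                                              
                                                                                
                                                                                 
                                                                       
                                                                              
                                                     

(** Write [p n] for [(Pbar R n).[x]]. The recursion gives [(a + b) * p (a + b)] as [x] times a
    convolution of [sigmabar] with [p]; cut it at index [b]. Induction on [a + b] bounds the terms
    with index at least [b] by [a * (p a * p b)]. The other terms are at most [b * (p a * p b)] as
    soon as [sigmabar (a + k) <= p a * sigmabar k] for [0 < k <= a] ([sigmabar_shift_le]). That
    comparison follows from [2k <= sigmabar k <= k(k+1)] once [p a] exceeds [(a+1)(a+2)/2], which
    [Pbar_horner_gt] gives for [a >= 5]; smaller [a] are checked on explicit values. Strictness of
    the comparison at [k = b] alone makes the result strict ([Pbar_horner_submul_lt]), and for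
    [0 < b <= a] this fails only in the two exceptional cases. *)

(** * Linear lower and quadratic upper bounds on [sigmabar] *)

Lemma sigma_ge (n : nat) : (0 < n)%N -> (n <= sigma n)%N.
Proof.
by move=> n_gt0; rewrite /sigma (big_rem n) ?divisors_id //= leq_addr.
Qed.

Lemma sigma_le (n : nat) : (0 < n)%N -> (2 * sigma n <= n * n.+1)%N.
Proof.
move=> n_gt0; have ->: sigma n = (\sum_(0 <= d < n.+1 | (d %| n)%N) d)%N.
  rewrite /sigma -[RHS]big_filter; apply: perm_big; apply: uniq_perm.
  - exact: divisors_uniq.
  - by rewrite filter_uniq ?iota_uniq.
  move=> d; rewrite mem_filter mem_index_iota -dvdn_divisors //.
  by case: (boolP (d %| n)%N) => //= /(dvdn_leq n_gt0); rewrite ltnS => ->.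
apply: (@leq_trans (2 * \sum_(0 <= d < n.+1) d)%N).
  rewrite leq_mul2l /= [leqRHS](bigID (fun d => (d %| n)%N)) /=.
  exact: leq_addr.
by rewrite mul2n bin2_sum bin2 /= mulnC; lia.
Qed.

Lemma sigmabar_decomp (n : nat) : (0 < n)%N ->
  exists m l, [/\ (0 < l)%N, n = (2 ^ m * l)%N
    & sigmabar n = (2 ^ m.+1 * sigma l)%N].
Proof.
move=> n_gt0; have dvd_n : (2 ^ logn 2 n %| n)%N by exact: pfactor_dvdnn.
exists (logn 2 n), (n %/ 2 ^ logn 2 n)%N; split=> //.
  by rewrite divn_gt0 ?expn_gt0 // dvdn_leq.
by rewrite mulnC divnK.
Qed.

Lemma sigmabar_ge (n : nat) : (0 < n)%N -> (2 * n <= sigmabar n)%N.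
Proof.
move=> /sigmabar_decomp[m [l [l_gt0 -> ->]]].
by rewrite expnS -mulnA !leq_mul2l sigma_ge ?orbT.
Qed.

(** With [n = 2^m l], the bound [2 sigma l <= l(l+1)] gives [sigmabar n <= 2^m l (l+1)], and
    [l <= n]. *)
Lemma sigmabar_le (n : nat) : (0 < n)%N -> (sigmabar n <= n * n.+1)%N.
Proof.
move=> /sigmabar_decomp[m [l [l_gt0 -> ->]]].
rewrite expnSr -mulnA -mulnA leq_mul2l; apply/orP; right.
apply: leq_trans (sigma_le l l_gt0) _; rewrite leq_mul2l ltnS leq_pmull ?orbT //.
by rewrite expn_gt0.
Qed.

(** The table stops at 8 because [sigmabar (a + k)] is evaluated by hand only for [k <= a <= 4].
    Stated as one list equality, it splits by injectivity under [case:]. *)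
Lemma sigmabar_small :
  [seq sigmabar k | k <- iota 1 8] = [:: 2; 4; 8; 8; 12; 16; 16; 16]%N.
Proof. by rewrite /sigmabar /sigma unlock; vm_compute. Qed.

(** * The recursion at a point [x >= 1] and the first values *)

Section Evaluation.

Variables (R : realFieldType) (x : R).

Local Notation p n := (Pbar R n).[x].

Lemma Pbar_horner_rec (n : nat) :
  n%:R * p n = x * \sum_(j < n) (sigmabar (n - j))%:R * p j.
Proof.
case: n => [|n]; first by rewrite big_ord0 mul0r mulr0.
rewrite PbarE // hornerM hornerZ hornerX !mulrA mulfV ?mul1r ?pnatr_eq0 //.
congr (_ * _); rewrite horner_sum big_add1 /= big_nat_rev /= big_mkord.
apply: eq_bigr => j _; rewrite hornerZ add0n ?subSS.
by have j_lt := ltn_ord j; congr ((sigmabar _)%:R * (Pbar R _).[x]); lia.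
Qed.

Hypothesis x_ge1 : 1 <= x.

Let x_gt0 : 0 < x := lt_le_trans ltr01 x_ge1.
Let x_ge0 : 0 <= x := ltW x_gt0.

Lemma Pbar_horner_gt0 (n : nat) : 0 < p n.
Proof.
elim/ltn_ind: n => [[|n]] IHn; first by rewrite Pbar0 hornerE.
rewrite -(@pmulr_rgt0 _ n.+1%:R) ?ltr0Sn // Pbar_horner_rec.
apply: mulr_gt0 => //.
rewrite big_ord_recl /= ltr_pwDl //.
  rewrite mulr_gt0 ?IHn // ltr0n; apply: leq_trans (sigmabar_ge _ _) => //.
by apply: sumr_ge0 => j _; rewrite mulr_ge0 ?ler0n //; apply/ltW/IHn/ltn_ord.
Qed.

Lemma Pbar_horner_ge_sum (n : nat) :
  \sum_(j < n) (sigmabar (n - j))%:R * p j <= n%:R * p n.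
Proof.
rewrite Pbar_horner_rec ler_peMl //.
by apply: sumr_ge0 => j _; rewrite mulr_ge0 ?ler0n // ltW // Pbar_horner_gt0.
Qed.

Lemma Pbar_horner0 : p 0 = 1.
Proof. by rewrite Pbar0 hornerE. Qed.

Lemma Pbar_horner1 : p 1 = 2 * x.
Proof.
case: sigmabar_small => s1 _ _ _ _ _ _ _; have := Pbar_horner_rec 1.
rewrite !big_ord_recr big_ord0 /= ?subSS ?subn0 s1 Pbar_horner0; lra.
Qed.

Lemma Pbar_horner2 : p 2 = 2 * x ^+ 2 + 2 * x.
Proof.
case: sigmabar_small => s1 s2 _ _ _ _ _ _; have := Pbar_horner_rec 2.
rewrite !big_ord_recr big_ord0 /= ?subSS ?subn0 s1 s2.
rewrite Pbar_horner0 Pbar_horner1; lra.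
Qed.

(** The bounds are the values at [x = 1], the overpartition numbers 2, 4, 8, 14, 24. *)
Lemma Pbar_horner_small :
  [/\ 2 <= p 1, 4 <= p 2, 8 <= p 3, 14 <= p 4 & 24 <= p 5].
Proof.
have p0 := Pbar_horner0.
have p1 : 2 <= p 1 by rewrite Pbar_horner1; move: x_ge1; lra.
have p2 : 4 <= p 2 by rewrite Pbar_horner2; move: x_ge1 (exprn_ege1 2 x_ge1); lra.
case: sigmabar_small => s1 s2 s3 s4 s5 _ _ _.
have p3 : 8 <= p 3.
  have := Pbar_horner_ge_sum 3.
  by rewrite !big_ord_recr big_ord0 /= ?subSS ?subn0 s1 s2 s3; lra.
have p4 : 14 <= p 4.
  have := Pbar_horner_ge_sum 4.
  by rewrite !big_ord_recr big_ord0 /= ?subSS ?subn0 s1 s2 s3 s4; lra.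
have p5 : 24 <= p 5.
  have := Pbar_horner_ge_sum 5.
  by rewrite !big_ord_recr big_ord0 /= ?subSS ?subn0 s1 s2 s3 s4 s5; lra.
by split.
Qed.

(** * Quadratic growth of [p] *)

(** Used at [y = m = n]; keeping [y] separate from [m] lets the induction on [m] go through. *)
Lemma sum_quadratic_convolution (y : R) (m : nat) :
  \sum_(j < m) (y - j%:R) * ((j%:R + 1) * (j%:R + 2) - 4) =
  y * (m%:R * (m%:R + 1) * (m%:R + 2) / 3 - 4 * m%:R)
  - ((m%:R - 1) * m%:R * (m%:R + 1) * (m%:R + 2) / 4 - 2 * m%:R * (m%:R - 1)).
Proof.
elim: m => [|m IHm]; first by rewrite big_ord0; field.
by rewrite big_ord_recr /= IHm -natr1; field.
Qed.

                                                                              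
                                                                               
                                                                 
(** Convolving the weak bound on [p j] with [2k <= sigmabar k] gives a quartic lower bound for
    [n * p n], enough to recover the lost 4. The constant 4 is the least making the weak bound true
    at [n = 2, 3] when [x = 1]. *)
Lemma Pbar_horner_gt_step (n : nat) : (6 <= n)%N ->
  (forall j, (j < n)%N -> (j%:R + 1) * (j%:R + 2) - 4 <= 2 * p j) ->
  (n%:R + 1) * (n%:R + 2) < 2 * p n.
Proof.
move=> n_ge6 IHn; have n_ge6R : 6 <= n%:R :> R by rewrite (ler_nat R 6 n).
have n_gt0 : 0 < n%:R :> R by lra.
have term j : (j < n)%N ->
    (n%:R - j%:R) * ((j%:R + 1) * (j%:R + 2) - 4)
      <= (sigmabar (n - j))%:R * p j.
  move=> j_lt; have pj := Pbar_horner_gt0 j.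
  have s_ge : 2 * (n%:R - j%:R) <= (sigmabar (n - j))%:R :> R.
    by rewrite -natrB 1?ltnW // -(natrM R 2) ler_nat sigmabar_ge ?subn_gt0.
  apply: le_trans (ler_wpM2r (ltW pj) s_ge).
  rewrite [2 * _]mulrC -mulrA ler_wpM2l ?IHn //.
  by rewrite subr_ge0 ler_nat ltnW.
(* The strict gain comes from [j = 0], where the left term is [-2n] and the right one is positive.
   It is essential at [n = 6], where the polynomial slack below vanishes. *)
have strict : \sum_(j < n) (n%:R - j%:R) * ((j%:R + 1) * (j%:R + 2) - 4)
    < \sum_(j < n) (sigmabar (n - j))%:R * p j.
  case: n n_ge6 n_ge6R n_gt0 IHn term => // n n_ge6 n_ge6R n_gt0 IHn term.
  rewrite big_ord_recl [ltRHS]big_ord_recl /= ltr_leD //.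
    rewrite subn0 Pbar_horner0 mulr1 subr0.
    have : (2 * n.+1)%:R <= (sigmabar n.+1)%:R :> R.
      by rewrite ler_nat sigmabar_ge.
    by rewrite natrM; lra.
  by apply: ler_sum => j _; apply: (term (lift ord0 j)).
have := lt_le_trans strict (Pbar_horner_ge_sum n).
rewrite sum_quadratic_convolution.
move: (p n) n_ge6R n_gt0 => P; set y : R := n%:R => y_ge6 y_gt0 lt_P.
(* One twelfth of this product is the closed form at [m = y] minus [y(y+1)(y+2)/2]; hence the
   threshold 6. *)
have : 0 <= y * (y + 1) * ((y - 6) * (y + 5)) by rewrite !mulr_ge0 //; lra.
by rewrite -(ltr_pM2l y_gt0); lra.
Qed.

Lemma Pbar_horner_ge (n : nat) : (n%:R + 1) * (n%:R + 2) - 4 <= 2 * p n.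
Proof.
have [p1 p2 p3 p4 p5] := Pbar_horner_small; have p0 := Pbar_horner0.
elim/ltn_ind: n => n IHn; have [n_ge6|] := leqP 6 n.
  by have := Pbar_horner_gt_step n n_ge6 IHn; lra.
by case: n IHn => [|[|[|[|[|[|//]]]]]] _ _; lra.
Qed.

Lemma Pbar_horner_gt (n : nat) :
  (5 <= n)%N -> (n%:R + 1) * (n%:R + 2) < 2 * p n.
Proof.
rewrite leq_eqVlt => /predU1P[<-|n_ge6]; last first.
  by apply: Pbar_horner_gt_step => // j _; exact: Pbar_horner_ge.
by have [_ _ _ _ p5] := Pbar_horner_small; lra.
Qed.

(** * Comparing [sigmabar (a + k)] with [p a * sigmabar k] *)

Lemma sigmabar_shift_lt (a k : nat) : (3 <= a)%N -> (0 < k <= a)%N ->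
  (sigmabar (a + k))%:R < p a * (sigmabar k)%:R.
Proof.
move=> a_ge3 /andP[k_gt0 k_le]; have pa := Pbar_horner_gt0 a.
have [a_ge5|a_lt5] := leqP 5 a; last first.
  have [_ _ p3 p4 _] := Pbar_horner_small.
  case: sigmabar_small => s1 s2 s3 s4 s5 s6 s7 s8.
  case: a a_ge3 a_lt5 pa k_le => [|[|[|[|[|//]]]]] // _ _ _;
  by case: k k_gt0 => [|[|[|[|[|//]]]]] // _ _ /=;
     rewrite ?addnS ?addn0 ?s1 ?s2 ?s3 ?s4 ?s5 ?s6 ?s7 ?s8; lra.
have k_ge1R : 1 <= k%:R :> R by rewrite ler1n.
have k_leR : k%:R <= a%:R :> R by rewrite ler_nat.
have s_ge : 2 * k%:R <= (sigmabar k)%:R :> R.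
  by rewrite -(natrM R 2) ler_nat sigmabar_ge.
have s_le : (sigmabar (a + k))%:R <= (a%:R + k%:R) * (a%:R + k%:R + 1) :> R.
  by rewrite -natrD natr1 -natrM ler_nat sigmabar_le // addn_gt0 k_gt0 orbT.
apply: le_lt_trans s_le _; apply: lt_le_trans (ler_wpM2l (ltW pa) s_ge).
have := Pbar_horner_gt a a_ge5; move: (p a) => P lt_P.
have k_gt0R : 0 < k%:R :> R by lra.
rewrite mulrCA mulrA [X in _ < X](_ : _ = k%:R * (2 * P)); last by ring.
apply: le_lt_trans (_ : _ <= k%:R * ((a%:R + 1) * (a%:R + 2))) _.
  (* This product equals [k(a+1)(a+2) - (a+k)(a+k+1)]. It vanishes at [k = 1], which is why the
     growth bound has the form [(a+1)(a+2)]. *)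
  have : 0 <= (k%:R - 1) * (a%:R * a%:R + a%:R - k%:R) :> R.
    by rewrite mulr_ge0 ?subr_ge0 //; nra.
  by lra.
by rewrite ltr_pM2l.
Qed.

Lemma sigmabar_shift_le (a k : nat) : (0 < k <= a)%N ->
  (sigmabar (a + k))%:R <= p a * (sigmabar k)%:R.
Proof.
move=> k_bnd; have [a_ge3|] := leqP 3 a; first exact/ltW/sigmabar_shift_lt.
have [p1 p2 _ _ _] := Pbar_horner_small.
case: sigmabar_small => s1 s2 s3 s4 _ _ _ _.
by case: a k_bnd => [|[|[|//]]]; case: k => [|[|[|//]]] //= _ _;
   rewrite ?addnS ?addn0 ?s1 ?s2 ?s3 ?s4; lra.
Qed.

(** * Submultiplicativity, weak then strict *)

(** The terms of index [b + i] carry the weight [sigmabar (a - i)]; after bounding [p (b + i)], the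
    recursion for [a] resums them to [a * (p a * p b)]. The terms of index below [b] are kept as
    they are. *)
Lemma Pbar_horner_split (a b : nat) :
  (forall i, (i < a)%N -> p (b + i) <= p b * p i) ->
  (a + b)%:R * p (a + b) <=
  a%:R * (p a * p b) + x * \sum_(j < b) (sigmabar (a + (b - j)))%:R * p j.
Proof.
move=> IH; rewrite Pbar_horner_rec addnC big_split_ord /= mulrDr addrC lerD //; last first.
  rewrite ler_wpM2l // ler_sum // => j _.
  by have /ltnW j_le := ltn_ord j; rewrite (addnC b) addnBA.
rewrite mulrA Pbar_horner_rec -mulrA ler_wpM2l // mulr_suml ler_sum // => i _.
by rewrite subnDl -mulrA ler_wpM2l ?ler0n // mulrC IH.
Qed.

Lemma shift_sum_le (a b : nat) : (b <= a)%N ->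
  x * \sum_(j < b) (sigmabar (a + (b - j)))%:R * p j <= b%:R * (p a * p b).
Proof.
move=> le_ba; rewrite mulrCA Pbar_horner_rec mulrCA ler_wpM2l // mulr_sumr ler_sum // => j _.
rewrite mulrA ler_wpM2r ?(ltW (Pbar_horner_gt0 _)) // sigmabar_shift_le //.
by rewrite subn_gt0 ltn_ord (leq_trans (leq_subr _ _)).
Qed.

(** Only the term [j = 0], where [k = b] and [p 0 = 1], has to be strict. *)
Lemma shift_sum_lt (a b : nat) : (0 < b <= a)%N ->
  (sigmabar (a + b))%:R < p a * (sigmabar b)%:R ->
  x * \sum_(j < b) (sigmabar (a + (b - j)))%:R * p j < b%:R * (p a * p b).
Proof.
case: b => // b /= le_ba lt_b.
rewrite mulrCA Pbar_horner_rec mulrCA ltr_pM2l // mulr_sumr.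
rewrite big_ord_recl [ltRHS]big_ord_recl /= ltr_leD //.
  by rewrite subn0 Pbar_horner0 !mulr1.
apply: ler_sum => j _; rewrite mulrA ler_wpM2r ?(ltW (Pbar_horner_gt0 _)) //.
rewrite sigmabar_shift_le // subn_gt0 ltnS ltn_ord /=.
exact: leq_trans (leq_subr _ _) le_ba.
Qed.

(** The weak form, with zero indices and no order on [a], [b], is what the induction can carry: the
    split calls it at [(b, i)] for every [i < a], and [i = 0] is an equality. *)
Lemma Pbar_horner_submul (a b : nat) : p (a + b) <= p a * p b.
Proof.
have [n] := ubnP (a + b); elim: n a b => // n IHn a b.
wlog le_ba : a b / (b <= a)%N.
  move=> wlg; case/orP: (leq_total b a) => [/wlg//|/wlg].
  by rewrite addnC mulrC.
rewrite ltnS => le_n; case: (posnP (a + b)) => [|ab_gt0].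
  by move/eqP; rewrite addn_eq0 => /andP[/eqP-> /eqP->]; rewrite Pbar_horner0 mulr1.
have ab_gt0R : 0 < (a + b)%:R :> R by rewrite ltr0n.
rewrite -(ler_pM2l ab_gt0R).
have IH i : (i < a)%N -> p (b + i) <= p b * p i.
  by move=> lt_ia; apply: IHn; apply: leq_trans le_n; rewrite addnC ltn_add2r.
apply: le_trans (Pbar_horner_split a b IH) _.
by rewrite natrD mulrDl lerD2l shift_sum_le.
Qed.

Lemma Pbar_horner_submul_lt (a b : nat) : (0 < b <= a)%N ->
  (sigmabar (a + b))%:R < p a * (sigmabar b)%:R -> p (a + b) < p a * p b.
Proof.
move=> b_bnd lt_b; have /andP[b_gt0 _] := b_bnd.
have ab_gt0 : 0 < (a + b)%:R :> R by rewrite ltr0n addn_gt0 b_gt0 orbT.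
rewrite -(ltr_pM2l ab_gt0).
apply: le_lt_trans (Pbar_horner_split a b _) _.
  by move=> i _; exact: Pbar_horner_submul.
by rewrite natrD mulrDl ltrD2l shift_sum_lt.
Qed.

End Evaluation.

(** * The exceptional cases *)

Theorem theorem1p7 (R : realType) (a b : nat) (x : R) :
  (0 < b)%N -> (b <= a)%N -> 1 <= x ->
  ((Pbar R a).[x] * (Pbar R b).[x] > (Pbar R (a + b)).[x] <->
   ~ ((a, b, x) = (1%N, 1%N, 1) \/ (a, b, x) = (2%N, 1%N, 1))).
Proof.
move=> b_gt0 le_ba x_ge1.
case: sigmabar_small => s1 s2 s3 s4 _ _ _ _.
have P1 := Pbar_horner1 R; have P2 := Pbar_horner2 R.
split.
  move=> lt_ab [] [ea eb ex]; move: lt_ab; rewrite ea eb ex.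
    by rewrite [(1 + 1)%N]/= P1 P2; lra.
  (* At [x = 1] the recursion gives [p 3 = 8 = p 2 * p 1], an equality. *)
  have := Pbar_horner_rec R 1 3.
  rewrite !big_ord_recr big_ord0 /= ?subSS ?subn0 s1 s2 s3.
  by rewrite Pbar_horner0 P1 P2; lra.
move=> not_exc; apply: Pbar_horner_submul_lt => //; first exact/andP.
have [a_ge3|a_lt3] := leqP 3 a.
  by apply: sigmabar_shift_lt => //; exact/andP.
(* For [a <= 2], [b = 1], the comparison at [k = b] is an equality at [x = 1] and strict beyond; the
   case [(2, 2)] is strict already at [x = 1]. *)
have x_gt1 : b = 1%N -> 1 < x.
  move=> b1; rewrite lt_neqAle x_ge1 andbT eq_sym; apply/eqP => x1.
  apply: not_exc; rewrite b1 x1.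
  by case: a le_ba a_lt3 => [|[|[|//]]]; rewrite ?b1 // => _ _; [left|right].
case: a le_ba a_lt3 {not_exc} => [|[|[|//]]];
  case: b b_gt0 x_gt1 => [|[|[|//]]] //= _ x_gt1 _ _.
- by rewrite addn1 s1 s2 P1; have := x_gt1 erefl; lra.
- by rewrite addn1 s1 s3 P2; have := x_gt1 erefl; nra.
- by rewrite [(2 + 2)%N]/= s2 s4 P2; nra.
Qed.
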